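(* Let $\gamma\colon\Omega^\lozenge\to\mathcal{C}$ be any computable forecasting system, let $\omega=(x_1,\dots,x_n,\dots)\in\Omega$ be any outcome sequence that is computably random for $\gamma$, and let $f$ be any computable gamble on $\{0,1\}$. If $S\colon\Omega^\lozenge\to\{0,1\}$ is any computable selection process such that $\sum_{k=0}^{n}S(x_1,\dots,x_k)\to+\infty$ as $n\to+\infty$, then also $$\liminf_{n\to+\infty}\frac{\sum_{k=0}^{n-1}S(x_1,\dots,x_k)\left[f(x_{k+1})-\underline{E}_{\gamma(x_1,\dots,x_k)}(f)\right]}{\sum_{k=0}^{n-1}S(x_1,\dots,x_k)}\ge 0.$$
   Context: $\mathbb{N}=\{1,2,\dots\}$, $\mathbb{N}_0=\mathbb{N}\cup\{0\}$. A gamble on $\{0,1\}$ is a map $f\colon\{0,1\}\to\mathbb{R}$. $\mathcal{C}$ is the set of all non-empty closed subintervals of $[0,1]$ (interval forecasts). For $I\in\mathcal{C}$, $\underline{E}_I(f)=\min_{p\in I}[pf(1)+(1-p)f(0)]$ and $\overline{E}_I(f)=\max_{p\in I}[pf(1)+(1-p)f(0)]$. $\Omega=\{0,1\}^{\mathbb{N}}$ is the set of outcome sequences and $\Omega^\lozenge=\bigcup_{n\in\mathbb{N}_0}\{0,1\}^n$ the set of situations, with $\square$ the empty sequence; $(x_1,\dots,x_k)$ for $k=0$ means $\square$. For $\omega\in\Omega$, $\omega^n$ is its initial segment of length $n$. A forecasting system is a map $\gamma\colon\Omega^\lozenge\to\mathcal{C}$. A real process is a map $F\colon\Omega^\lozenge\to\mathbb{R}$,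 with process difference $\Delta F(s)(x)=F(sx)-F(s)$. A selection process is a map $S\colon\Omega^\lozenge\to\{0,1\}$. A supermartingale for $\gamma$ is a real process $M$ with $\overline{E}_{\gamma(s)}(\Delta M(s))\le 0$ for all $s\in\Omega^\lozenge$; a test supermartingale for $\gamma$ is a non-negative supermartingale $T$ for $\gamma$ with $T(\square)=1$. A real number is computable if some computable sequence of rationals converges to it effectively. A real process $F$ is computable if there are rational numbers $r_{s,n}=(-1)^{\sigma(s,n)}a(s,n)/b(s,n)$, with $a,b,\sigma\colon\Omega^\lozenge\times\mathbb{N}_0\to\mathbb{N}_0$ computable and $b>0$, and a computable function $e\colon\Omega^\lozenge\times\mathbb{N}_0\to\mathbb{N}_0$, such that $n\ge e(s,N)$ implies $|r_{s,n}-F(s)|\le 2^{-N}$ for all $s,n,N$. A gamble $f$ on $\{0,1\}$ is computable if $f(0)$ and $f(1)$ are computable reals. A forecasting system $\gamma$ is computable if the real processes $s\mapsto\min\gamma(s)$ and $s\mapsto\max\gamma(s)$ are computable. An outcome sequence $\omega$ is computably random for $\gamma$ if $\sup_{n\in\mathbb{N}}T(\omega^n)<+\infty$ for every computable test supermartingale $T$ for $\gamma$. *)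

(* Defs.v *)
From mathcomp Require Import all_boot all_order all_algebra.
From mathcomp Require Import all_classical all_reals all_analysis.

Set Implicit Arguments.
Unset Strict Implicit.
Unset Printing Implicit Defensive.

Import Order.TTheory GRing.Theory Num.Theory.
Import numFieldNormedType.Exports.

Local Open Scope classical_set_scope.
Local Open Scope ring_scope.

(* Computability on natural numbers: Kleene's partial recursive functions,
   as programs with a big-step semantics.  [evals c v y] means that [c] halts
   on the argument list [v] with output [y]; divergence is the absence of
   such a [y]. *)
Inductive program : Type :=
| PZero
| PSucc
| PProj of nat
| PComp of program & seq program
| PRec of program & program
| PMin of program.

Inductive evals : program -> seq nat -> nat -> Prop :=
| EZero v : evals PZero v 0
| ESucc x v : evals PSucc (x :: v) x.+1
| EProj i v : (i < size v)%N -> evals (PProj i) v (nth 0%N v i)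
| EComp g hs v w y : evals_seq hs v w -> evals g w y -> evals (PComp g hs) v y
| ERec0 g h v y : evals g v y -> evals (PRec g h) (0%N :: v) y
| ERecS g h n v r y : evals (PRec g h) (n :: v) r ->
    evals h [:: n, r & v] y -> evals (PRec g h) (n.+1 :: v) y
| EMin g v n (k : nat -> nat) : evals g (n :: v) 0 ->
    (forall m, (m < n)%N -> evals g (m :: v) (k m).+1) -> evals (PMin g) v n
with evals_seq : seq program -> seq nat -> seq nat -> Prop :=
| ENil v : evals_seq [::] v [::]
| ECons h hs v y w : evals h v y -> evals_seq hs v w ->
    evals_seq (h :: hs) v (y :: w).

Definition computable_nat (f : nat -> nat) : Prop :=
  exists c, forall n, evals c [:: n] (f n).

(* Outcomes 0 and 1 are [false] and [true]; [rcons s x] is the situation sx. *)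
Definition situation := seq bool.

(* Effective injective coding of situations: the binary numeral 1 x_1 ... x_k. *)
Definition sit_code (s : situation) : nat :=
  foldl (fun n (x : bool) => (2 * n + x)%N) 1%N s.

Definition computable_sit (f : situation -> nat -> nat) : Prop :=
  exists c, forall s n, evals c [:: sit_code s; n] (f s n).

(* Outcome sequences are indexed from 0: [w k] is x_{k+1}. *)
Definition outcome_seq := nat -> bool.

Definition initial_segment (w : outcome_seq) (n : nat) : situation := mkseq w n.

Definition signed_fraction (R : realType) (sg a b : nat) : R :=
  (-1) ^+ sg * a%:R / b%:R.

Definition computable_real (R : realType) (x : R) : Prop :=
  exists sg a b e : nat -> nat,
    [/\ computable_nat sg, computable_nat a, computable_nat b,
        computable_nat e & forall n, (0 < b n)%N] /\
    forall n N, (e N <= n)%N ->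
      `|signed_fraction R (sg n) (a n) (b n) - x| <= 2 ^- N.

Definition real_process (R : realType) := situation -> R.

Definition computable_process (R : realType) (F : real_process R) : Prop :=
  exists sg a b e : situation -> nat -> nat,
    [/\ computable_sit sg, computable_sit a, computable_sit b,
        computable_sit e & forall s n, (0 < b s n)%N] /\
    forall s n N, (e s N <= n)%N ->
      `|signed_fraction R (sg s n) (a s n) (b s n) - F s| <= 2 ^- N.

Definition gamble (R : realType) := bool -> R.

Definition computable_gamble (R : realType) (f : gamble R) : Prop :=
  computable_real (f false) /\ computable_real (f true).

(* The interval [fmin, fmax], a non-empty closed subinterval of [0, 1]. *)
Record interval_forecast (R : realType) := IntervalForecast {
  fmin : R;
  fmax : R;
  forecast_bounds : [&& 0 <= fmin, fmin <= fmax & fmax <= 1]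
}.

(* The set is the continuous image of a non-empty compact interval, so the
   infimum and the supremum below are a minimum and a maximum. *)
Definition lower_expectation (R : realType) (I : interval_forecast R)
    (f : gamble R) : R :=
  inf [set p * f true + (1 - p) * f false | p in `[fmin I, fmax I]].

Definition upper_expectation (R : realType) (I : interval_forecast R)
    (f : gamble R) : R :=
  sup [set p * f true + (1 - p) * f false | p in `[fmin I, fmax I]].

Definition forecasting_system (R : realType) := situation -> interval_forecast R.

Definition computable_forecasting_system (R : realType)
    (gamma : forecasting_system R) : Prop :=
  computable_process (fun s => fmin (gamma s)) /\
  computable_process (fun s => fmax (gamma s)).

Definition process_difference (R : realType) (F : real_process R)
    (s : situation) : gamble R :=
  fun x => F (rcons s x) - F s.

Definition supermartingale (R : realType) (gamma : forecasting_system R)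
    (M : real_process R) : Prop :=
  forall s, upper_expectation (gamma s) (process_difference M s) <= 0.

Definition test_supermartingale (R : realType) (gamma : forecasting_system R)
    (T : real_process R) : Prop :=
  [/\ supermartingale gamma T, forall s, 0 <= T s & T [::] = 1].

Definition computably_random (R : realType) (gamma : forecasting_system R)
    (w : outcome_seq) : Prop :=
  forall T : real_process R,
    test_supermartingale gamma T -> computable_process T ->
    (ereal_sup [set (T (initial_segment w n))%:E | n in [set n | (0 < n)%N]]
      < +oo)%E.

Definition selection_process := situation -> bool.

(* A selection process is a real process with values in {0, 1}. *)
Definition computable_selection (R : realType) (S : selection_process) : Prop :=
  computable_process (fun s => (S s)%:R : R).

(* Main.v *)
Require Import Defs.
From mathcomp Require Import all_boot all_order all_algebra.
From mathcomp Require Import all_classical all_reals all_analysis.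
From mathcomp Require Import zify ring lra.

Set Implicit Arguments.
Unset Strict Implicit.
Unset Printing Implicit Defensive.

Import Order.TTheory GRing.Theory Num.Theory.
Import numFieldNormedType.Exports.

Local Open Scope classical_set_scope.

(* For the outcome [b] at which [f] is larger, [f x] minus its lower expectation
   is [|f 1 - f 0|] times [(x = b) - u], where [u] is the lower probability of
   [b]; hence only the selected frequency of [b] matters.  If it stayed below the
   average of [u] by [e] infinitely often, then betting the fixed fraction [1/K]
   of the current capital against [b] at every selected step would make the
   capital grow like [exp (c * number of selected steps)] at these times, by
   [1 + y >= exp (y - 2 y^2)].  With [K] a large power of [2] and [u] replaced by
   a computable multiple of [1/K] in [u - 3/K, u], the capital is still a test
   supermartingale, and it is an exactly computable fraction of integers. *)

(** * Closure properties of computable functions *)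

(** A function of [k] arguments is taken as a function of the argument list, so that arities are
    plain numbers; lists of other lengths are unconstrained. *)
Definition computable_fun (k : nat) (f : seq nat -> nat) : Prop :=
  exists c, forall v, size v = k -> evals c v (f v).

Definition computable_nat2 (F : nat -> nat -> nat) : Prop :=
  exists c, forall m n, evals c [:: m; n] (F m n).

Lemma evals_map_proj v (l : seq nat) :
  all (fun i => i < size v) l ->
  evals_seq (map PProj l) v (map (nth 0 v) l).
Proof.
elim: l => [_|i l IH] /=; first exact: ENil.
by case/andP=> hi hl; apply: ECons; [exact: EProj | exact: IH].
Qed.

Lemma evals_seq_iota v p n : p + n <= size v ->
  evals_seq (map PProj (iota p n)) v (take n (drop p v)).
Proof.
move=> hpn; rewrite -(@map_nth_iota _ 0) ?size_drop ?leq_subRL //; last first.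
  exact: leq_trans (leq_addr _ _) hpn.
by apply: evals_map_proj; apply/allP => i; rewrite mem_iota => /andP[_ /leq_trans]; apply.
Qed.

Lemma computable_fun_ext k f g :
  computable_fun k f -> (forall v, size v = k -> f v = g v) ->
  computable_fun k g.
Proof. by case=> c hc fg; exists c => v hv; rewrite -fg //; exact: hc. Qed.

Lemma computable_fun_proj k i : i < k -> computable_fun k (nth 0 ^~ i).
Proof. by move=> hi; exists (PProj i) => v hv; apply: EProj; rewrite hv. Qed.

Lemma computable_fun_comp k (F : nat -> nat) g :
  computable_nat F -> computable_fun k g -> computable_fun k (fun v => F (g v)).
Proof.
move=> [c hc] [d hd]; exists (PComp c [:: d]) => v hv.
by apply: (EComp (w := [:: g v])) => //; apply: ECons (hd _ hv) (ENil _).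
Qed.

Lemma computable_fun_comp2 k F g h :
  computable_nat2 F -> computable_fun k g -> computable_fun k h ->
  computable_fun k (fun v => F (g v) (h v)).
Proof.
move=> [c hc] [d hd] [e he]; exists (PComp c [:: d; e]) => v hv.
apply: (EComp (w := [:: g v; h v])) => //.
exact: ECons (hd _ hv) (ECons (he _ hv) (ENil _)).
Qed.

Lemma computable_fun_const k m : computable_fun k (fun=> m).
Proof.
elim: m => [|m [c hc]]; first by exists PZero => v _; exact: EZero.
exists (PComp PSucc [:: c]) => v hv.
by apply: (EComp (w := [:: m])) (ESucc _ _); apply: ECons (hc _ hv) (ENil _).
Qed.

(** The recursion bound is itself computed from the arguments: the program puts [b v] in front of a
    copy of [v] and runs [PRec] on the result. *)
Lemma computable_fun_rec k b g h :
  computable_fun k b -> computable_fun k g -> computable_fun k.+2 h ->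
  computable_fun k (fun v =>
    nat_rect (fun=> nat) (g v) (fun i r => h [:: i, r & v]) (b v)).
Proof.
move=> [pb hb] [pg hg] [ph hh].
exists (PComp (PRec pg ph) (pb :: map PProj (iota 0 k))) => v hv.
apply: (EComp (w := b v :: v)).
  apply: ECons (hb _ hv) _; have := @evals_seq_iota v 0 k.
  by rewrite drop0 take_oversize hv //; apply.
elim: (b v) => [|n IH]; first exact: ERec0 (hg _ hv).
by apply: ERecS IH (hh _ _); rewrite /= hv.
Qed.

(** Makes [h] usable as a recursion step by skipping position 1, which holds the accumulator. *)
Lemma computable_fun_weaken k h : computable_fun k.+1 h ->
  computable_fun k.+2 (fun u => h (nth 0 u 0 :: drop 2 u)).
Proof.
move=> [c hc]; exists (PComp c (map PProj (0 :: iota 2 k))) => u hu.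
apply: (EComp (w := nth 0 u 0 :: drop 2 u)); last first.
  by apply: hc; rewrite /= size_drop hu subn2.
apply: ECons; first by apply: EProj; rewrite hu.
have := @evals_seq_iota u 2 k.
by rewrite take_oversize ?size_drop ?hu ?subn2 //; apply.
Qed.

Lemma computable_nat2_fun F :
  computable_fun 2 (fun v => F (nth 0 v 0) (nth 0 v 1)) -> computable_nat2 F.
Proof. by case=> c hc; exists c => m n; apply: hc [:: m; n] _. Qed.

Lemma computable_nat_fun F :
  computable_fun 1 (fun v => F (nth 0 v 0)) -> computable_nat F.
Proof. by case=> c hc; exists c => m; apply: hc [:: m] _. Qed.

Lemma computable_succn : computable_nat succn.
Proof. by exists PSucc => n; exact: ESucc. Qed.

Lemma computable_predn : computable_nat predn.
Proof.
apply: computable_nat_fun.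
have := computable_fun_rec (computable_fun_proj (ltnSn 0))
  (computable_fun_const 1 0) (@computable_fun_proj 3 0 isT).
by move=> /computable_fun_ext; apply => v _; case: (nth _ _ _).
Qed.

Lemma computable_addn : computable_nat2 addn.
Proof.
apply: computable_nat2_fun.
have := computable_fun_rec (@computable_fun_proj 2 0 isT)
  (@computable_fun_proj 2 1 isT)
  (computable_fun_comp computable_succn (@computable_fun_proj 4 1 isT)).
move=> /computable_fun_ext; apply => v _.
by elim: (nth 0 v 0) => //= n ->.
Qed.

Lemma computable_subn : computable_nat2 subn.
Proof.
apply: computable_nat2_fun.
have := computable_fun_rec (@computable_fun_proj 2 1 isT)
  (@computable_fun_proj 2 0 isT)
  (computable_fun_comp computable_predn (@computable_fun_proj 4 1 isT)).
move=> /computable_fun_ext; apply => v _.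
by elim: (nth 0 v 1) => [|n]; rewrite ?subn0 //= => ->; rewrite subnS.
Qed.

(** One recursion covers bounded sums and products; multiplication, powers, division and the length
    of a coded situation follow from it. The recursion puts the new term on the left, hence the use
    of commutativity. *)
Lemma computable_fun_bigop idx (op : Monoid.com_law idx) k b h :
  computable_nat2 op -> computable_fun k b -> computable_fun k.+1 h ->
  computable_fun k (fun v => \big[op/idx]_(i < b v) h (val i :: v)).
Proof.
move=> hop hb hh.
have := computable_fun_rec hb (computable_fun_const k idx)
  (computable_fun_comp2 hop (computable_fun_weaken hh)
     (@computable_fun_proj k.+2 1 isT)).
move=> /computable_fun_ext; apply => v _ /=; rewrite drop0.
by elim: (b v) => [|n IH]; rewrite ?big_ord0 // big_ord_recr /= Monoid.mulmC IH.
Qed.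

Lemma computable_muln : computable_nat2 muln.
Proof.
apply: computable_nat2_fun.
have := computable_fun_bigop computable_addn (@computable_fun_proj 2 0 isT)
  (@computable_fun_proj 3 2 isT).
by move=> /computable_fun_ext; apply => v _ /=; rewrite sum_nat_const card_ord.
Qed.

Lemma computable_leq : computable_nat2 (fun m n => m <= n).
Proof.
apply: computable_nat2_fun.
(* The truth value of [m <= n] is [1 - (m - n)] in truncated subtraction. *)
have := computable_fun_comp2 computable_subn (computable_fun_const 2 1)
  (computable_fun_comp2 computable_subn (@computable_fun_proj 2 0 isT)
    (@computable_fun_proj 2 1 isT)).
move=> /computable_fun_ext; apply => v _ /=.
by rewrite -subn_eq0; case: (nth 0 v 0 - nth 0 v 1).
Qed.

Lemma computable_expn : computable_nat2 expn.
Proof.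
apply: computable_nat2_fun.
have := computable_fun_bigop computable_muln (@computable_fun_proj 2 1 isT)
  (@computable_fun_proj 3 1 isT).
by move=> /computable_fun_ext; apply => v _ /=; rewrite prod_nat_const card_ord.
Qed.

Lemma sum_nat_leq_index n m : \sum_(i < n) (i < m) = minn n m.
Proof.
elim: n => [|n IH]; first by rewrite big_ord0 min0n.
by rewrite big_ord_recr /= IH; case: (ltnP n m) => /= ?; lia.
Qed.

(** For [d > 0], the quotient of [m] by [d] counts the [i < m] with [i.+1 * d <= m]; the extra
    factor [1 <= d] produces the conventional value 0 at [d = 0]. *)
Lemma computable_divn : computable_nat2 divn.
Proof.
apply: computable_nat2_fun.
have := computable_fun_bigop computable_addn (@computable_fun_proj 2 0 isT)
  (computable_fun_comp2 computable_leq
    (computable_fun_comp2 computable_muln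
       (computable_fun_comp computable_succn (@computable_fun_proj 3 0 isT))
       (@computable_fun_proj 3 2 isT)) (@computable_fun_proj 3 1 isT)).
have hpos := computable_fun_comp2 computable_leq (computable_fun_const 2 1)
  (@computable_fun_proj 2 1 isT).
move=> /(computable_fun_comp2 computable_muln hpos) /computable_fun_ext.
apply => v _ /=; case: (posnP (nth 0 v 1)) => [->|d0]; first by rewrite divn0.
rewrite mul1n; under eq_bigr do rewrite -leq_divRL //.
by rewrite sum_nat_leq_index; apply/minn_idPr; rewrite leq_div.
Qed.

(** * Codes of situations *)

Lemma sit_code_rcons s x : sit_code (rcons s x) = 2 * sit_code s + x.
Proof. by rewrite /sit_code foldl_rcons. Qed.

Lemma sit_code_bounds s : 2 ^ size s <= sit_code s < 2 ^ (size s).+1.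
Proof.
elim/last_ind: s => [|s x IH] //.
by rewrite sit_code_rcons size_rcons !expnS in IH *; case: x; lia.
Qed.

Lemma sit_code_gt0 s : 0 < sit_code s.
Proof.
by have /andP[+ _] := sit_code_bounds s; apply: leq_trans; rewrite expn_gt0.
Qed.

Lemma sit_code_inj : injective sit_code.
Proof.
elim/last_ind=> [|s x IH] t; case/lastP: t => [|t y] //.
- rewrite sit_code_rcons => h; have := sit_code_gt0 t.
  by rewrite /sit_code /= in h *; lia.
- rewrite sit_code_rcons => h; have := sit_code_gt0 s.
  by rewrite /sit_code /= in h *; lia.
rewrite !sit_code_rcons => h; have xy : x = y by case: x y h => [] [] //=; lia.
by rewrite xy (IH t) //; rewrite xy in h; lia.
Qed.

Lemma sit_code_surj n : 0 < n -> exists s, sit_code s = n.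
Proof.
elim/ltn_ind: n => n IH n0.
have [n1|n1] := leqP n 1; first by exists [::]; rewrite /sit_code /=; lia.
have [||s hs] := IH n./2; [lia|lia|].
exists (rcons s (odd n)); rewrite sit_code_rcons hs mul2n addnC.
exact: odd_double_half.
Qed.

(* A program for [F] need not halt when its first argument is [0], which codes
   no situation; [G] is made total by feeding it [1] instead. *)
Lemma computable_sit_nat2 F : computable_sit F ->
  exists2 G, computable_nat2 G & forall s n, G (sit_code s) n = F s n.
Proof.
move=> [c hc].
have /choice [d hd] n : exists s, sit_code s = n + (n <= 0).
  by apply: sit_code_surj; case: n.
have [e he] : computable_fun 2 (fun v => nth 0 v 0 + (nth 0 v 0 <= 0)).
  apply: (computable_fun_comp2 computable_addn); first exact: computable_fun_proj.
  apply: (computable_fun_comp2 computable_leq); first exact: computable_fun_proj.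
  exact: computable_fun_const.
exists (fun n => F (d n)) => [|s n]; last first.
  by congr F; apply: sit_code_inj; rewrite hd leqNgt sit_code_gt0 addn0.
exists (PComp c [:: e; PProj 1]) => m n.
apply: (EComp (w := [:: sit_code (d m); n])) (hc _ _); rewrite hd.
by apply: ECons (he [:: m; n] _) (ECons _ (ENil _)) => //; apply: EProj.
Qed.

Lemma computable_sit_code F : computable_nat F ->
  computable_sit (fun s _ => F (sit_code s)).
Proof.
move=> hF; have [c hc] := computable_fun_comp hF (@computable_fun_proj 2 0 isT).
by exists c => s n; apply: (hc [:: sit_code s; n]).
Qed.

(** By [sit_code_bounds], the length of [s] is the number of [i] with [2 ^ i.+1 <= sit_code s], and
    all such [i] lie below the code. *)
Lemma computable_size :
  exists2 L, computable_nat L & forall s, L (sit_code s) = size s.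
Proof.
exists (fun c => \sum_(i < c) (2 ^ i.+1 <= c)) => [|s]; last first.
  have /andP[lo hi] := sit_code_bounds s.
  rewrite (eq_bigr (fun i : 'I_ _ => nat_of_bool (i < size s))) => [|i _].
    rewrite sum_nat_leq_index; apply/minn_idPr.
    exact: leq_trans (ltnW (ltn_expl _ (isT : 1 < 2))) lo.
  congr nat_of_bool; apply/idP/idP => h; last first.
    by apply: leq_trans lo; rewrite leq_exp2l.
  by have := leq_ltn_trans h hi; rewrite ltn_exp2l.
apply: computable_nat_fun.
apply: (computable_fun_bigop computable_addn
  (h := fun u => 2 ^ (nth 0 u 0).+1 <= nth 0 u 1)).
  exact: computable_fun_proj.
apply: (computable_fun_comp2 computable_leq); last exact: computable_fun_proj.
apply: (computable_fun_comp2 computable_expn); first exact: computable_fun_const.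
by apply: (computable_fun_comp computable_succn); exact: computable_fun_proj.
Qed.

(* [sit_code s %/ 2 ^ i] is the code of the prefix of [s] of length
   [size s - i]; the empty prefix is left out. *)
Definition prefix_prod (W : nat -> nat) (s : situation) : nat :=
  \prod_(i < size s) W (sit_code s %/ 2 ^ i).

(** Halving the code of [rcons s x] gives back the code of [s], so all factors but the first are
    those of [s]. *)
Lemma prefix_prod_rcons W s x :
  prefix_prod W (rcons s x) = W (sit_code (rcons s x)) * prefix_prod W s.
Proof.
rewrite /prefix_prod size_rcons big_ord_recl expn0 divn1; congr (_ * _).
apply: eq_bigr => i _; rewrite /= /bump /= add1n expnS divnMA sit_code_rcons.
by congr (W (_ %/ _)); case: x; lia.
Qed.

Lemma computable_prefix_prod W : computable_nat W ->
  computable_sit (fun s _ => prefix_prod W s).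
Proof.
move=> hW; have [L hL sizeL] := computable_size.
have /computable_sit_code [c hc] :
    computable_nat (fun c => \prod_(i < L c) W (c %/ 2 ^ i)).
  apply: computable_nat_fun.
  apply: (computable_fun_bigop computable_muln
    (h := fun u => W (nth 0 u 1 %/ 2 ^ nth 0 u 0))).
    by apply: (computable_fun_comp hL); exact: computable_fun_proj.
  apply: (computable_fun_comp hW).
  apply: (computable_fun_comp2 computable_divn); first exact: computable_fun_proj.
  apply: (computable_fun_comp2 computable_expn); first exact: computable_fun_const.
  exact: computable_fun_proj.
by exists c => s n; rewrite /prefix_prod -sizeL; exact: hc.
Qed.

(** * Integer approximations of computable processes *)

Local Open Scope ring_scope.

(* As [F] is nonnegative, dropping the sign of the approximating fractions does
   not increase the error. *)
Lemma computable_process_approx (R : realType) (F : real_process R) (N : nat) :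
  computable_process F -> (forall s, 0 <= F s) ->
  exists A B : nat -> nat, [/\ computable_nat A, computable_nat B,
    forall s, (0 < B (sit_code s))%N &
    forall s, `|(A (sit_code s))%:R / (B (sit_code s))%:R - F s| <= 2 ^- N].
Proof.
move=> [sg [a [b [e [[_ /computable_sit_nat2[A hA AE]
  /computable_sit_nat2[B hB BE] /computable_sit_nat2[E hE EE] b0] hF]]]]] F0.
have comp G : computable_nat2 G -> computable_nat (fun c => G c (E c N)).
  move=> hG; apply: computable_nat_fun.
  apply: (computable_fun_comp2 hG); first exact: computable_fun_proj.
  apply: (computable_fun_comp2 hE); first exact: computable_fun_proj.
  exact: computable_fun_const.
exists (fun c => A c (E c N)), (fun c => B c (E c N)).
split=> [||s|s]; rewrite ?BE ?AE ?EE //; try exact: comp.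
apply: le_trans (hF s (e s N) N (leqnn _)).
rewrite -[X in `|_ - X|]ger0_norm // -[X in `|X - _|]ger0_norm ?divr_ge0 //.
apply: le_trans (ler_dist_dist _ _); rewrite /signed_fraction -mulrA normrMsign.
by rewrite lexx.
Qed.

(** Scaled by [2 ^ N], an approximation within [2 ^- N] is off by at most 1, and taking its floor
    loses less than 1 more. Subtracting 1 from the floor turns it into a lower bound, less than 3
    below the target. *)
Lemma computable_process_floor (R : realType) (F : real_process R) (N : nat) :
  computable_process F -> (forall s, 0 <= F s) ->
  exists2 m, computable_nat m & forall s,
    F s * 2 ^+ N - 3 <= (m (sit_code s))%:R <= F s * 2 ^+ N.
Proof.
move=> hF F0; have [A [B [hA hB B0 hAB]]] := computable_process_approx N hF F0.
exists (fun c => (A c * 2 ^ N %/ B c - 1)%N) => [|s].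
  apply: computable_nat_fun.
  apply: (computable_fun_comp2 computable_subn); last exact: computable_fun_const.
  apply: (computable_fun_comp2 computable_divn); last first.
    by apply: (computable_fun_comp hB); exact: computable_fun_proj.
  apply: (computable_fun_comp2 computable_muln); last exact: computable_fun_const.
  by apply: (computable_fun_comp hA); exact: computable_fun_proj.
move: (F0 s) (B0 s) (hAB s); set a := A _; set b := B _; set x := F s => x0 b0 h.
have b0R : 0 < b%:R :> R by rewrite ltr0n.
have K0 : 0 < 2 ^+ N :> R by rewrite exprn_gt0.
have {h} : `|a%:R * 2 ^+ N / b%:R - x * 2 ^+ N| <= 1.
  rewrite mulrAC -mulrBl normrM (gtr0_norm K0) -ler_pdivlMr //.
  by rewrite div1r.
set q := (a * 2 ^ N %/ b)%N.
have qlo : q%:R <= a%:R * 2 ^+ N / b%:R :> R.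
  by rewrite ler_pdivlMr // -natrX -!natrM ler_nat leq_divM.
have qhi : a%:R * 2 ^+ N / b%:R < q%:R + 1 :> R.
  by rewrite ltr_pdivrMr // -natrX natr1 -!natrM ltr_nat ltn_ceil.
rewrite ler_norml => /andP[h1 h2].
have xK0 : 0 <= x * 2 ^+ N by rewrite mulr_ge0 // ltW.
(* At [q = 0] the subtraction of 1 truncates to 0, a lower bound because [F] is nonnegative. *)
have [q0|q0] := posnP q.
  by rewrite q0 sub0n; rewrite q0 in qhi; apply/andP; split; lra.
by rewrite natrB //; apply/andP; split; lra.
Qed.

(** An approximation within [1/4] of a value in {0, 1} determines it by comparison with [1/2], that
    is, [b <= 2 * a] for the fraction [a / b]. *)
Lemma computable_selection_nat (R : realType) (S : selection_process) :
  computable_selection R S ->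
  exists2 sigma, computable_nat sigma & forall s, sigma (sit_code s) = S s.
Proof.
move=> hS; have S0 s : 0 <= (S s)%:R :> R by [].
have [A [B [hA hB B0 hAB]]] := computable_process_approx 2 hS S0.
exists (fun c => (B c <= 2 * A c)%N) => [|s].
  apply: computable_nat_fun.
  apply: (computable_fun_comp2 computable_leq).
    by apply: (computable_fun_comp hB); exact: computable_fun_proj.
  apply: (computable_fun_comp2 computable_muln); first exact: computable_fun_const.
  by apply: (computable_fun_comp hA); exact: computable_fun_proj.
move: (B0 s) (hAB s); set a := A _; set b := B _ => b0.
have b0R : 0 < b%:R :> R by rewrite ltr0n.
rewrite ler_norml => /andP[]; set r := _ / _ => h1 h2; congr nat_of_bool.
have -> : (b <= 2 * a)%N = (2^-1 <= r).
  by rewrite /r ler_pdivlMr // ler_pdivrMl // -natrM ler_nat.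
have e4 : 2 ^- 2 = 4^-1 :> R by rewrite -natrX.
rewrite e4 in h1 h2; apply/idP/idP => h; first by case: (S s) h2 => //= h2; lra.
by rewrite h /= in h1; lra.
Qed.

(** * Lower probabilities and growth of the capital *)

Definition lower_probability (R : realType) (I : interval_forecast R) (b : bool) : R :=
  if b then fmin I else 1 - fmax I.

Lemma lower_probability_itv (R : realType) (I : interval_forecast R) b :
  0 <= lower_probability I b <= 1.
Proof.
case: I => l h lh; rewrite /lower_probability /=.
by move: (lh) => /and3P[l0 hl h1]; case: b; apply/andP; split; lra.
Qed.

(** The expectation is affine in [p], so its minimum is attained at the end of the interval where
    the better outcome [b] is least probable. *)
Lemma lower_expectationE (R : realType) (I : interval_forecast R) (f : gamble R) :
  let b := f false <= f true in
  lower_expectation I f =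
    f (~~ b) + (f b - f (~~ b)) * lower_probability I b.
Proof.
case: I => l h lh; rewrite /lower_expectation /lower_probability /=.
have /and3P[l0 hl h1] := lh.
set E := [set _ | _ in _].
suff min_E m : E m -> lbound E m -> inf E = m.
  case: leP => f01 /=; apply: min_E.
  - by exists l; [rewrite /= in_itv /= lexx | ring].
  - move=> _ [p + <-]; rewrite /= in_itv /= => /andP[lp ph].
    have : 0 <= (p - l) * (f true - f false) by rewrite mulr_ge0 ?subr_ge0.
    by lra.
  - by exists h; [rewrite /= in_itv /= lexx andbT | ring].
  - move=> _ [p + <-]; rewrite /= in_itv /= => /andP[lp ph].
    have : 0 <= (h - p) * (f false - f true) by rewrite mulr_ge0 ?subr_ge0 // ltW.
    by lra.
move=> Em lbm; apply/eqP; rewrite eq_le lb_le_inf ?andbT //; last by exists m.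
by apply: ge_inf => //; exists m.
Qed.

Lemma sub_lower_expectation (R : realType) (I : interval_forecast R) (f : gamble R) x :
  let b := f false <= f true in
  f x - lower_expectation I f =
    `|f true - f false| * ((x == b)%:R - lower_probability I b).
Proof.
rewrite /= lower_expectationE; case: leP => f01.
  by rewrite ger0_norm ?subr_ge0 //; case: x => /=; ring.
by rewrite ltr0_norm ?subr_lt0 //; case: x => /=; ring.
Qed.

(** For [p] in the interval, the expected increment is [T s * c s * (v s - P)], where [P] is the
    probability of [b]; it is at most 0 since [v s] is at most the lower probability of [b], hence
    at most [P]. *)
Lemma supermartingale_bet (R : realType) (gamma : forecasting_system R) b
    (T c v : real_process R) :
  (forall s, 0 <= T s) -> (forall s, 0 <= c s) ->
  (forall s, v s <= lower_probability (gamma s) b) ->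
  (forall s x, T (rcons s x) = T s * (1 + c s * (v s - (x == b)%:R))) ->
  supermartingale gamma T.
Proof.
move=> T0 c0 hv hT s; apply: ge_sup.
  have /and3P[_ hl _] := forecast_bounds (gamma s).
  by eexists; exists (fmin (gamma s)); rewrite //= in_itv /= lexx.
move=> _ [p + <-]; rewrite /= in_itv /= => /andP[lp ph].
rewrite /process_difference !hT.
have vp : v s <= if b then p else 1 - p.
  by apply: le_trans (hv s) _; rewrite /lower_probability; case: (b); lra.
have : 0 <= T s * c s * ((if b then p else 1 - p) - v s).
  by rewrite !mulr_ge0 ?subr_ge0.
by case: b {hv hT} vp => /= _; nra.
Qed.

(** With [z = y - 2 * y ^+ 2], inverting [1 - z <= expR (- z)] bounds [expR z] by [1 / (1 - z)], and
    [(1 + y) * (1 - z) = 1 + y ^+ 2 * (1 + 2 * y)] is at least 1. *)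
Lemma expR_le1D (R : realType) (y : R) :
  `|y| <= 2^-1 -> expR (y - 2 * y ^+ 2) <= 1 + y.
Proof.
rewrite ler_norml => /andP[y1 y2].
have h : 0 < 1 - (y - 2 * y ^+ 2) by nra.
have := expR_ge1Dx (- (y - 2 * y ^+ 2)); rewrite expRN => h1.
rewrite -[leLHS]invrK invf_ple ?posrE ?invr_gt0 ?expR_gt0 //; last lra.
apply: le_trans h1; rewrite -[leLHS]mul1r ler_pdivrMr; last lra.
have : 0 <= y ^+ 2 * (1 + 2 * y) by rewrite mulr_ge0 ?sqr_ge0 //; lra.
by nra.
Qed.

Lemma initial_segmentS w n : initial_segment w n.+1 = rcons (initial_segment w n) (w n).
Proof. exact: mkseqS. Qed.

Lemma expR_sum_le_process (R : realType) (T : real_process R)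
    (y : situation -> gamble R) (w : outcome_seq) n :
  T [::] = 1 ->
  (forall s x, T (rcons s x) = T s * (1 + y s x)) ->
  (forall s x, `|y s x| <= 2^-1) ->
  expR (\sum_(0 <= k < n) (y (initial_segment w k) (w k) -
    2 * y (initial_segment w k) (w k) ^+ 2)) <= T (initial_segment w n).
Proof.
move=> T1 hT hy; elim: n => [|n IH]; first by rewrite big_geq // expR0 T1.
rewrite big_nat_recr //= expRD initial_segmentS hT.
by rewrite ler_pM ?expR_ge0 // expR_le1D.
Qed.

(** * The betting process *)

Section BettingProcess.
Variables (R : realType) (gamma : forecasting_system R) (b : bool).
Variables (S : selection_process) (N : nat) (m sigma : nat -> nat).
Hypothesis mP : forall s, lower_probability (gamma s) b * 2 ^+ N - 3 <=
  (m (sit_code s))%:R <= lower_probability (gamma s) b * 2 ^+ N.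
Hypothesis sigmaP : forall s, sigma (sit_code s) = S s.

(* The numerator over [4 ^ N] of the factor by which the capital changes when the
   situation coded by [d] is reached; [d %/ 2] codes its parent, and the
   subtraction never truncates. *)
Definition bet_weight (d : nat) : nat :=
  (2 ^ N * 2 ^ N + sigma (d %/ 2) * m (d %/ 2) -
     sigma (d %/ 2) * ((d %% 2 == b) * 2 ^ N))%N.

Definition bet_process : real_process R :=
  fun s => (prefix_prod bet_weight s)%:R / (((2 ^ N * 2 ^ N) ^ size s)%N)%:R.

(** The relative gain from staking the fraction [2 ^- N] of the capital against [b], at the price
    [m / 2 ^ N], in selected situations only. *)
Definition bet_return (s : situation) (x : bool) : R :=
  (S s)%:R / 2 ^+ N * ((m (sit_code s))%:R / 2 ^+ N - (x == b)%:R).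

Lemma bet_process_rcons s x :
  bet_process (rcons s x) = bet_process s * (1 + bet_return s x).
Proof.
have K0 : 2 ^+ N != 0 :> R by rewrite expf_neq0.
rewrite /bet_process prefix_prod_rcons size_rcons expnSr mulnC natrM.
rewrite natrM invfM mulrACA; congr (_ * _).
rewrite /bet_weight sit_code_rcons.
have -> : ((2 * sit_code s + x) %/ 2 = sit_code s)%N by case: x; lia.
have -> : ((2 * sit_code s + x) %% 2 = x)%N by case: x; lia.
(* The subtracted term is at most [2 ^ N <= 2 ^ N * 2 ^ N], so the subtraction is exact. *)
rewrite sigmaP natrB; last first.
  have : (0 < 2 ^ N)%N by rewrite expn_gt0.
  set K := (2 ^ N)%N; set z := (S s * m _)%N => K0'.
  have : (K <= K * K)%N by rewrite leq_pmulr.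
  by case: (S s); case: eqP => //= _; lia.
have -> : (x == b :> nat) = (x == b) by case: x; case: (b).
rewrite /bet_return natrD !natrM !natrX.
by field.
Qed.

Lemma bet_process_nil : bet_process [::] = 1.
Proof. by rewrite /bet_process /prefix_prod big_ord0 expn0 divr1. Qed.

Lemma bet_process_ge0 s : 0 <= bet_process s.
Proof. by rewrite /bet_process divr_ge0. Qed.

Lemma bet_process_test_supermartingale : test_supermartingale gamma bet_process.
Proof.
split; [|exact: bet_process_ge0|exact: bet_process_nil].
have K0 : 0 < 2 ^+ N :> R by rewrite exprn_gt0.
apply: (@supermartingale_bet _ _ b _ (fun s => (S s)%:R / 2 ^+ N)
  (fun s => (m (sit_code s))%:R / 2 ^+ N)) => [||s|s x].
- exact: bet_process_ge0.
- by move=> s; rewrite divr_ge0 // ltW.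
- by rewrite ler_pdivrMr //; have /andP[] := mP s.
- exact: bet_process_rcons.
Qed.

Lemma bet_process_computable :
  computable_nat m -> computable_nat sigma -> computable_process bet_process.
Proof.
move=> hm hsigma.
have p0 : computable_fun 1 (nth 0%N ^~ 0%N) by exact: computable_fun_proj.
have half : computable_fun 1 (fun v => nth 0 v 0 %/ 2)%N.
  by apply: (computable_fun_comp2 computable_divn) => //; exact: computable_fun_const.
have hW : computable_nat bet_weight.
  apply: computable_nat_fun.
  apply: (computable_fun_comp2 computable_subn).
    apply: (computable_fun_comp2 computable_addn); first exact: computable_fun_const.
    apply: (computable_fun_comp2 computable_muln).
      exact: (computable_fun_comp hsigma).
    exact: (computable_fun_comp hm).
  apply: (computable_fun_comp2 computable_muln).
    exact: (computable_fun_comp hsigma).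
  apply: (computable_fun_comp2 computable_muln); last exact: computable_fun_const.
  have hmod : computable_fun 1 (fun v => nth 0 v 0 - nth 0 v 0 %/ 2 * 2)%N.
    apply: (computable_fun_comp2 computable_subn) => //.
    by apply: (computable_fun_comp2 computable_muln) => //; exact: computable_fun_const.
  (* The test [d %% 2 == b] is the last bit of [d] or its complement, according to [b]. *)
  case: (b).
    apply: (computable_fun_ext hmod) => v _; lia.
  have := computable_fun_comp2 computable_subn (computable_fun_const 1 1) hmod.
  by move=> /computable_fun_ext; apply => v _; lia.
have hK : computable_nat (fun=> 2 ^ N * 2 ^ N)%N.
  by apply: computable_nat_fun; exact: computable_fun_const.
have h0 : computable_nat (fun=> 0%N).
  by apply: computable_nat_fun; exact: computable_fun_const.
(* The fraction is exact: it does not depend on the precision index, and the modulus can be 0. The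
   denominator is the prefix product of a constant. *)
exists (fun _ _ => 0%N), (fun s _ => prefix_prod bet_weight s),
  (fun s _ => prefix_prod (fun=> 2 ^ N * 2 ^ N)%N s), (fun _ _ => 0%N).
have den s : prefix_prod (fun=> 2 ^ N * 2 ^ N)%N s = ((2 ^ N * 2 ^ N) ^ size s)%N.
  by rewrite /prefix_prod prod_nat_const card_ord.
split; first split.
- exact: (computable_sit_code h0).
- exact: computable_prefix_prod.
- exact: computable_prefix_prod.
- exact: (computable_sit_code h0).
- by move=> s _; rewrite den expn_gt0 muln_gt0 expn_gt0.
move=> s n M _; rewrite /signed_fraction expr0 mul1r den subrr normr0.
by rewrite invr_ge0 exprn_ge0.
Qed.

(** The 5 is 3 + 2: rounding the price costs at most [3 / 2 ^ N] per selected step, and the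
    quadratic term [2 * y ^+ 2] of a return [y] at most [2 / 2 ^ N], both before the final division
    by [2 ^ N]. *)
Lemma bet_process_growth w n : (0 < N)%N ->
  expR ((\sum_(0 <= k < n) (S (initial_segment w k))%:R *
           (lower_probability (gamma (initial_segment w k)) b - (w k == b)%:R)
         - 5 / 2 ^+ N * \sum_(0 <= k < n) (S (initial_segment w k))%:R) / 2 ^+ N)
  <= bet_process (initial_segment w n).
Proof.
move=> N0; have K0 : 0 < 2 ^+ N :> R by rewrite exprn_gt0.
have K2 : 2 <= 2 ^+ N :> R.
  by case: N N0 => // j _; rewrite exprS ler_peMr // exprn_ege1 // ler1n.
have diff_le s x : `|(m (sit_code s))%:R / 2 ^+ N - (x == b)%:R| <= 1 :> R.
  have /andP[_ u1] := lower_probability_itv (gamma s) b.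
  have /andP[_] := mP s; rewrite -ler_pdivrMr // => m1.
  have : 0 <= (m (sit_code s))%:R / 2 ^+ N :> R by rewrite divr_ge0 // ltW.
  by rewrite ler_norml; case: (x == b) => /=; lra.
have stake_le s : 0 <= ((S s)%:R / 2 ^+ N : R) <= 2^-1.
  rewrite divr_ge0 ?ler_pdivrMr //=.
  by case: (S s) => /=; lra.
have return_le s x : `|bet_return s x| <= 2^-1.
  rewrite /bet_return normrM -[leRHS]mulr1 ler_pM //.
  by have /andP[? ?] := stake_le s; rewrite ger0_norm.
apply: le_trans (expR_sum_le_process w n bet_process_nil bet_process_rcons return_le).
rewrite ler_expR mulr_sumr -sumrB mulr_suml; apply: ler_sum => k _.
set s := initial_segment w k; rewrite /bet_return.
set z := (m _)%:R / _ - _.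
have : z ^+ 2 <= 1.
  by rewrite -[leLHS]ger0_norm ?sqr_ge0 // normrX expr_le1 // /z diff_le.
have : lower_probability (gamma s) b - (w k == b)%:R - 3 / 2 ^+ N <= z.
  have /andP[+ _] := mP s; rewrite -(@ler_pM2r _ (2 ^+ N)^-1) ?invr_gt0 //.
  rewrite mulrBl mulfK ?lt0r_neq0 //.
  by rewrite /z; lra.
move: z => z zlo z2.
case: (S s) => /=; last by rewrite !mul0r mulr0 subrr mul0r expr0n /= mulr0 subrr.
rewrite !mul1r mulr1.
set K := 2 ^+ N in K0 K2 zlo *.
have Ki : 0 < K^-1 by rewrite invr_gt0.
have : K^-1 ^+ 2 * z ^+ 2 <= K^-1 ^+ 2 by rewrite ler_piMr ?sqr_ge0.
have := ler_wpM2l (ltW Ki) zlo.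
by rewrite exprMn; nra.
Qed.
End BettingProcess.

(** * From bounded capital to selected frequencies and the lower limit *)

Lemma selected_frequency_ge (R : realType) (gamma : forecasting_system R)
    (hgamma : computable_forecasting_system gamma)
    (w : outcome_seq) (hw : computably_random gamma w)
    (S : selection_process) (hS : computable_selection R S)
    (hsum : (\sum_(0 <= k < n.+1) (S (initial_segment w k))%:R : R)
              @[n --> \oo] --> +oo) (b : bool) (e : R) :
  0 < e -> \forall n \near \oo,
  - e * (\sum_(0 <= k < n) (S (initial_segment w k))%:R) <=
  \sum_(0 <= k < n) (S (initial_segment w k))%:R *
     ((w k == b)%:R - lower_probability (gamma (initial_segment w k)) b).
Proof.
move=> e0.
(* [2 ^ N >= 10 / e] makes the loss [5 / 2 ^ N] per selected step at most [e / 2], so half of the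
   gap [e] survives. *)
pose N := (Num.bound (10 / e)).+1.
have eN : 10 / e <= 2 ^+ N.
  have := archi_boundP (ltW (divr_gt0 (ltr0n _ 10) e0)) => /ltW /le_trans; apply.
  by rewrite -natrX ler_nat ltnW // (ltn_trans (ltnSn _)) // ltn_expl.
have K0 : 0 < 2 ^+ N :> R by rewrite exprn_gt0.
have [m hm mP] : exists2 m, computable_nat m & forall s,
    lower_probability (gamma s) b * 2 ^+ N - 3 <= (m (sit_code s))%:R
      <= lower_probability (gamma s) b * 2 ^+ N.
  have bounds s := forecast_bounds (gamma s).
  case: b; first apply: (computable_process_floor N hgamma.1).
    by move=> s; case/and3P: (bounds s).
  have fmax0 s : 0 <= fmax (gamma s).
    by have /and3P[l0 lh _] := bounds s; exact: le_trans lh.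
  have [m hm mP] := computable_process_floor N hgamma.2 fmax0.
  (* An upper bound on [fmax] is needed to bound [1 - fmax] from below; [m c + 3] exceeds
     [fmax * 2 ^ N] by at most 3. If the subtraction truncates, [(1 - fmax) * 2 ^ N] is below 3 and
     0 is accurate enough. *)
  exists (fun c => 2 ^ N - (m c + 3))%N => [|s].
    apply: computable_nat_fun.
    apply: (computable_fun_comp2 computable_subn); first exact: computable_fun_const.
    apply: (computable_fun_comp2 computable_addn); last exact: computable_fun_const.
    by apply: (computable_fun_comp hm); exact: computable_fun_proj.
  have /and3P[_ _ h1] := bounds s; have /andP[m1 m2] := mP s.
  have : 0 <= (1 - fmax (gamma s)) * 2 ^+ N by rewrite mulr_ge0 ?subr_ge0 // ltW.
  rewrite /lower_probability /= mulrBl mul1r => p0.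
  have [mN|mN] := leqP (m (sit_code s) + 3) (2 ^ N).
    by rewrite natrB // natrX natrD; apply/andP; split; lra.
  have /eqP -> : (2 ^ N - (m (sit_code s) + 3) == 0)%N by rewrite subn_eq0 ltnW.
  rewrite p0 andbT; move: mN; rewrite -(ltr_nat R) natrX natrD; lra.
have [sigma hsigma sigmaP] := computable_selection_nat hS.
pose T := bet_process R b N m sigma.
have := hw T (bet_process_test_supermartingale mP sigmaP)
  (bet_process_computable R b N hm hsigma).
set sT := ereal_sup _ => sT_fin.
have [M TM] : exists M : R, forall n, (0 < n)%N -> T (initial_segment w n) <= M.
  have Tle n : (0 < n)%N -> ((T (initial_segment w n))%:E <= sT)%E.
    by move=> n0; apply: ereal_sup_ubound; exists n.
  (* The supremum is not [-oo], since it dominates the real value at [n = 1]. *)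
  have := Tle 1%N isT; case: sT sT_fin Tle => [M _ Tle _|//|_ _].
    by exists M => n n0; rewrite -lee_fin Tle.
  by rewrite leeNy_eq.
(* The threshold is chosen so that the surviving exponent [e / 2 * C / 2 ^ N] is at least [M], where
   [C] is the number of selected steps. *)
have {}hsum : \forall n \near \oo,
    (2 * 2 ^+ N * M / e <= \sum_(0 <= k < n) (S (initial_segment w k))%:R).
  by apply/near_inftyS; move/cvgryPge : hsum; apply.
near=> n.
rewrite leNgt; apply/negP => An.
have n0 : (0 < n)%N by near: n; exists 1%N.
have := le_trans (bet_process_growth mP sigmaP w n (ltn0Sn _)) (TM n n0).
(* By [1 + x <= expR x], an exponent of at least [M] already pushes the capital above its bound
   [M]. *)
apply/negP; rewrite -ltNge; apply: lt_le_trans (expR_ge1Dx _).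
have : 2 * 2 ^+ N * M / e <= \sum_(0 <= k < n) (S (initial_segment w k))%:R.
  by near: n.
have sumN : \sum_(0 <= k < n) (S (initial_segment w k))%:R *
    (lower_probability (gamma (initial_segment w k)) b - (w k == b)%:R) =
    - \sum_(0 <= k < n) (S (initial_segment w k))%:R *
    ((w k == b)%:R - lower_probability (gamma (initial_segment w k)) b).
  by rewrite -sumrN; apply: eq_bigr => k _; rewrite -mulrN opprB.
rewrite sumN; move: An.
have : 0 <= \sum_(0 <= k < n) (S (initial_segment w k))%:R :> R by rewrite sumr_ge0.
set A := \sum_(0 <= k < n) _ * _; set C := \sum_(0 <= k < n) _.
move=> C0 An; rewrite ler_pdivrMr // => CM.
suff : M <= (- A - 5 / 2 ^+ N * C) / 2 ^+ N by lra.
rewrite ler_pdivlMr //.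
have : 5 / 2 ^+ N * C <= e / 2 * C.
  rewrite ler_wpM2r // ler_pdivrMr //.
  by move: eN; rewrite ler_pdivrMr //; lra.
by lra.
Unshelve. all: by end_near. Qed.

Lemma limn_einf_ge0 (R : realType) (u : nat -> R) :
  (forall e, 0 < e -> \forall n \near \oo, - e <= u n) ->
  (0 <= limn_einf (fun n => (u n)%:E))%E.
Proof.
move=> hu; rewrite limn_einf_lim; apply/lee_addgt0Pr => e e0.
rewrite -leeBlDr // sub0e; apply: lime_ge; first exact: is_cvg_einfs.
have [N _ hN] := hu e e0.
exists N => // n /= Nn; apply: le_ereal_inf_tmp => _ [k /= nk <-].
by rewrite lee_fin; apply: hN; exact: leq_trans nk.
Qed.

Theorem theorem8 (R : realType) (gamma : forecasting_system R)
    (hgamma : computable_forecasting_system gamma)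
    (w : outcome_seq) (hw : computably_random gamma w)
    (f : gamble R) (hf : computable_gamble f)
    (S : selection_process) (hS : computable_selection R S)
    (hsum : (\sum_(0 <= k < n.+1) (S (initial_segment w k))%:R : R)
              @[n --> \oo] --> +oo) :
  (0 <= limn_einf (fun n : nat =>
    ((\sum_(0 <= k < n) (S (initial_segment w k))%:R *
        (f (w k) - lower_expectation (gamma (initial_segment w k)) f)) /
     (\sum_(0 <= k < n) (S (initial_segment w k))%:R))%:E))%E.
Proof.
apply: limn_einf_ge0 => e e0.
set D := `|f true - f false|.
(* [D] vanishes for a constant gamble, so [e] is divided by [D + 1]; [D * (e / (D + 1)) <= e] still
   holds. *)
have D1 : 0 < D + 1 by apply: ltr_wpDl; rewrite ?normr_ge0 ?ltr01.
near=> n.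
have : - (e / (D + 1)) * (\sum_(0 <= k < n) (S (initial_segment w k))%:R) <=
    \sum_(0 <= k < n) (S (initial_segment w k))%:R *
    ((w k == (f false <= f true))%:R -
     lower_probability (gamma (initial_segment w k)) (f false <= f true)).
  by near: n; apply: selected_frequency_ge; rewrite ?divr_gt0.
under [in X in _ -> X]eq_bigr do rewrite sub_lower_expectation mulrCA.
rewrite -mulr_sumr -/D.
have : 0 <= \sum_(0 <= k < n) (S (initial_segment w k))%:R :> R by rewrite sumr_ge0.
set A := \sum_(0 <= k < n) _ * _; set C := \sum_(0 <= k < n) _.
(* If nothing has been selected yet, the quotient has denominator 0 and equals 0 by convention. *)
rewrite le_eqVlt => /predU1P[<-|C0 AC].
  by move=> _; rewrite invr0 mulr0 oppr_le0 ltW.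
rewrite ler_pdivlMr //; apply: le_trans (ler_wpM2l (normr_ge0 _) AC).
rewrite !mulNr mulrN lerN2 mulrA ler_wpM2r ?(ltW C0) //.
rewrite mulrCA ger_pMr // ler_pdivrMr // mul1r lerDl ler01.
Unshelve. all: by end_near. Qed.
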